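(* Let $f:\mathbb{C}\to\mathbb{C}$ be a holomorphic function and let $n$ be a natural number. Suppose that for every integer $\lambda\ge 0$ there exist $2n+1$ functions $u_\lambda,v_{(1,\lambda)},\dots,v_{(n,\lambda)},w_{(1,\lambda)},\dots,w_{(n,\lambda)}:\mathbb{C}\to\mathbb{C}$ satisfying: (i) for every $m\in\{1,\dots,n\}$, $\displaystyle\lim_{h\to0}\frac{v_{(m,\lambda)}(h)}{h}=0$; (ii) for all $(x,h)\in\mathbb{C}\times\mathbb{C}$, $\displaystyle f^{(\lambda)}(x+h)-f^{(\lambda)}(x)=u_\lambda(h)f^{(\lambda+1)}(x)+\sum_{m=1}^n v_{(m,\lambda)}(h)w_{(m,\lambda)}(x)$. Suppose moreover that there is a summable set $\mathcal{U}$ such that $\displaystyle\bigcup_{\lambda\in\mathbb{N}}\{f^{(\lambda)},w_{(1,\lambda)},\dots,w_{(n,\lambda)}\}\subset\mathbf{S}(\mathcal{U})$. Then, for all $x,y\in\mathbb{C}$, $$\Sigma_{\mathcal{U}}(f;1,x)=\Sigma_{\mathcal{U}}(f;1,y)+\sum_{k=1}^\infty\Bigl(\mathrm{ess}\bigl(f^{(k-1)}\bigr)+\Sigma_{\mathcal{U}}(f^{(k)};1,y)\Bigr)\frac{(x-y)^k}{k!}.$$ In particular, for $y=0$, $$\Sigma_{\mathcal{U}}(f;1,x)=\sum_{k=1}^\infty\mathrm{ess}\bigl(f^{(k-1)}\bigr)\frac{x^k}{k!}.$$ Here $\mathrm{ess}$ denotes the essence relative to $\mathcal{U}$.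
   Context: Sets of functions. $\mathbb{C}^{\mathbb{C}}$ is the set of all functions $\mathbb{C}\to\mathbb{C}$; $\mathbb{N}$ includes $0$. For $X\subset\mathbb{C}^{\mathbb{C}}$: $\mathbf{L}(X)$ is the set of all (finite, complex) linear combinations of functions in $X$; $\mathbf{T}(X)$ is the set of all translates $x\mapsto g(x+c)$ with $g\in X$, $c\in\mathbb{C}$; and $\mathbf{S}(X):=\mathbf{L}(\mathbf{T}(X))$. Polynomial sums. For a complex polynomial $p$, let $P$ be the unique polynomial with $P(z)-P(z-1)=p(z)$ for all $z$ and $P(0)=0$; the fractional sum of $p$ from $x$ to $y$ is $P(y)-P(x-1)$, for $x,y\in\mathbb{C}$. Fractional summable functions. $f:\mathbb{C}\to\mathbb{C}$ is fractional summable if there are a degree bound $m$ and a sequence $(p_n)_{n\in\mathbb{N}}$ of polynomials of degree $\le m$ (the null polynomial has degree $-\infty$) such that $|f(n+x)-p_n(n+x)|\to 0$ as $n\to\infty$ for all $x\in\mathbb{C}$, and such that for all $x,y\in\mathbb{C}$ the limit as $n\to\infty$ of (fractional sum of $p_n$ from $n+x$ to $n+y$) $+\sum_{\nu=1}^n\bigl(f(\nu+x-1)-f(\nu+y)\bigr)$ exists. $\mathcal{F}$ is the set of functions $\mathbb{C}\to\mathbb{C}$ that are linear combinations of holomorphic (entire) functions and fractional summable functions. Summable sets. A set $\mathcal{U}\subset\mathcal{F}$ is a summable set if there is a unique map $\Sigma_{\mathcal{U}}:\mathbf{S}(\mathcal{U})\times\mathbb{C}^2\to\mathbb{C}$, $(f,x,y)\mapsto\Sigma_{\mathcal{U}}(f;x,y)$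 (thought of as ''$\sum_{k=x}^y f(k)$''), satisfying, for all $f,g\in\mathbf{S}(\mathcal{U})$ and $x,y,z,s,\lambda,\mu\in\mathbb{C}$: (A1) $\Sigma_{\mathcal{U}}(f;x,y)+\Sigma_{\mathcal{U}}(f;y+1,z)=\Sigma_{\mathcal{U}}(f;x,z)$; (A2) $\Sigma_{\mathcal{U}}(f;x+s,y+s)=\Sigma_{\mathcal{U}}(h;x,y)$ where $h(t)=f(t+s)$; (A3) $\Sigma_{\mathcal{U}}(\lambda f+\mu g;x,y)=\lambda\Sigma_{\mathcal{U}}(f;x,y)+\mu\Sigma_{\mathcal{U}}(g;x,y)$; (A4) $\Sigma_{\mathcal{U}}(f;1,1)=f(1)$; (A5* ) if $f$ is holomorphic, then $x\mapsto\Sigma_{\mathcal{U}}(f;1,x)$ is holomorphic on $\mathbb{C}$; (A6) if $\lim_{n\to\infty}f(t+n)=0$ for every $t\in\mathbb{C}$, then $\lim_{n\to\infty}\Sigma_{\mathcal{U}}(f(\cdot+n);x,y)=0$; moreover, if there is a sequence $(p_n)$ of polynomials of fixed degree (independent of $n$) with $|f(t+n)-p_n(t+n)|\to0$ for all $t\in\mathbb{C}$, then $\Sigma_{\mathcal{U}}(f(\cdot+n);x,y)$ minus the fractional sum of the polynomial $p_n(\cdot+n)$ from $x$ to $y$ tends to $0$ as $n\to\infty$. The map $\Sigma_{\mathcal{U}}$ is called the fractional sum relative to $\mathcal{U}$. Essence. For $f\in\mathbf{S}(\mathcal{U})$, the essence of $f$ relative to $\mathcal{U}$ is $\mathrm{ess}(f):=\lim_{h\to0}\frac1h\Sigma_{\mathcal{U}}(f;1,h)$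 ($h\in\mathbb{C}\setminus\{0\}$), if the limit exists; then $f$ is said to be a function with essence in $\mathcal{U}$. *)

(* Defs.v *)
From Stdlib Require Import Reals Arith.
From Coquelicot Require Import Coquelicot.
Open Scope R_scope.
Open Scope C_scope.

Definition NtoC (n : nat) : C := RtoC (INR n).

Definition entire (f : C -> C) : Prop := forall z : C, ex_derive f z.

(* [C_derive] is total; it is the complex derivative wherever the latter exists
   ([is_C_derive_unique]), in particular everywhere when [f] is entire. *)
Definition C_derive_n (f : C -> C) (n : nat) : C -> C := Nat.iter n C_derive f.

(* Sets of functions are predicates on [C -> C]. *)

Definition shift (c : C) (f : C -> C) : C -> C := fun t => f (t + c).

(* The empty combination ([n = 0]) gives the zero function. *)
Definition lin_comb (X : (C -> C) -> Prop) (f : C -> C) : Prop :=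
  exists (n : nat) (c : nat -> C) (g : nat -> C -> C),
    (forall k, (1 <= k <= n)%nat -> X (g k)) /\
    (forall z, f z = sum_n_m (fun k => c k * g k z) 1 n).

Definition translates (X : (C -> C) -> Prop) (f : C -> C) : Prop :=
  exists (g : C -> C) (c : C), X g /\ forall z, f z = g (z + c).

Definition S_space (X : (C -> C) -> Prop) : (C -> C) -> Prop :=
  lin_comb (translates X).

(* Complex polynomials are identified with the functions they define. *)

Definition poly_deg_le (m : nat) (p : C -> C) : Prop :=
  exists a : nat -> C, forall z, p z = sum_n (fun k => a k * z ^ k) m.

(* [None] is the degree -oo of the null polynomial. *)
Definition poly_of_deg (d : option nat) (p : C -> C) : Prop :=
  match d with
  | None => forall z, p z = 0
  | Some m => exists a : nat -> C,
      a m <> 0 /\ forall z, p z = sum_n (fun k => a k * z ^ k) m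
  end.

Definition is_poly (p : C -> C) : Prop := exists m, poly_deg_le m p.

(* For a polynomial [p] there is exactly one such [P]. *)
Definition is_antidiff (p P : C -> C) : Prop :=
  is_poly P /\ (forall z, P z - P (z - 1) = p z) /\ P 0 = 0.

(* The fractional sum from [x] to [y] of the polynomial [p] with
   [is_antidiff p P]. *)
Definition poly_frac_sum (P : C -> C) (x y : C) : C := P y - P (x - 1).

Definition frac_summable (f : C -> C) : Prop :=
  exists (m : nat) (p P : nat -> C -> C),
    (forall n, poly_deg_le m (p n)) /\
    (forall n, is_antidiff (p n) (P n)) /\
    (forall x, is_lim_seq
       (fun n => Cmod (f (NtoC n + x) - p n (NtoC n + x))) 0%R) /\
    (forall x y, exists l : C, filterlim
       (fun n => poly_frac_sum (P n) (NtoC n + x) (NtoC n + y)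
          + sum_n_m (fun nu => f (NtoC nu + x - 1) - f (NtoC nu + y)) 1 n)
       eventually (locally l)).

Definition F_class : (C -> C) -> Prop :=
  lin_comb (fun f => entire f \/ frac_summable f).

(* [Sigma f x y] only matters for [f] in [S_space U]. The polynomials in the
   second part of (A6) all have the same degree [d]. *)
Record frac_sum_axioms (U : (C -> C) -> Prop) (Sigma : (C -> C) -> C -> C -> C)
  : Prop := {
  frac_sum_A1 : forall f x y z, S_space U f ->
    Sigma f x y + Sigma f (y + 1) z = Sigma f x z;
  frac_sum_A2 : forall f x y s, S_space U f ->
    Sigma f (x + s) (y + s) = Sigma (shift s f) x y;
  frac_sum_A3 : forall f g x y lambda mu, S_space U f -> S_space U g ->
    Sigma (fun t => lambda * f t + mu * g t) x y
      = lambda * Sigma f x y + mu * Sigma g x y;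
  frac_sum_A4 : forall f, S_space U f -> Sigma f 1 1 = f 1;
  frac_sum_A5 : forall f, S_space U f -> entire f ->
    entire (fun x => Sigma f 1 x);
  frac_sum_A6_zero : forall f x y, S_space U f ->
    (forall t, filterlim (fun n => f (t + NtoC n)) eventually
                 (locally (RtoC 0))) ->
    filterlim (fun n => Sigma (shift (NtoC n) f) x y) eventually
      (locally (RtoC 0));
  frac_sum_A6_poly : forall f x y (d : option nat) (p Q : nat -> C -> C),
    S_space U f ->
    (forall n, poly_of_deg d (p n)) ->
    (forall t, is_lim_seq
       (fun n => Cmod (f (t + NtoC n) - p n (t + NtoC n))) 0%R) ->
    (forall n, is_antidiff (shift (NtoC n) (p n)) (Q n)) ->
    filterlim
      (fun n => Sigma (shift (NtoC n) f) x y - poly_frac_sum (Q n) x y)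
      eventually (locally (RtoC 0))
}.

Definition summable_set (U : (C -> C) -> Prop) : Prop :=
  (forall f, U f -> F_class f) /\
  (exists Sigma, frac_sum_axioms U Sigma) /\
  (forall Sigma1 Sigma2,
     frac_sum_axioms U Sigma1 -> frac_sum_axioms U Sigma2 ->
     forall f x y, S_space U f -> Sigma1 f x y = Sigma2 f x y).

Definition has_essence (Sigma : (C -> C) -> C -> C -> C) (f : C -> C) : Prop :=
  exists l : C, filterlim (fun h => 1 / h * Sigma f 1 h)
                  (locally' (RtoC 0)) (locally l).

(* [C_lim] is total; it is the limit wherever the latter exists
   ([is_C_lim_unique]), i.e. here when [has_essence Sigma f]. *)
Definition ess (Sigma : (C -> C) -> C -> C -> C) (f : C -> C) : C :=
  C_lim (fun h => 1 / h * Sigma f 1 h) 0.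

(* Main.v *)
(** The function [F x = Sigma f 1 x] satisfies
    [F (x + h) = F h + F x + u h * Sigma f' 1 x + sum_m v_m h * Sigma w_m 1 x],
    so all translates of [F] lie in one finite-dimensional space. Choosing
    interpolation nodes [x_j] for the span of these translates gives
    [F (x + h) = sum_j F (x_j + h) * b_j x] with [b_j] entire. Differentiating
    in [x] at the nodes shows that [h |-> (F (x_j + h))_j] solves a linear
    system with constant coefficients, hence the derivatives of [F] grow at
    most geometrically and [F] is the sum of its Taylor series; Cauchy's theory
    is not needed. Dividing the identity for [f^(k)] by [h] gives
    [(Sigma f^(k) 1 x)' = ess f^(k) + Sigma f^(k+1) 1 x], which identifies the
    Taylor coefficients. *)

Require Import Defs.
From Stdlib Require Import Reals Arith.
From Coquelicot Require Import Coquelicot.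
From Stdlib Require Import Lra Lia List FunctionalExtensionality Classical.
Open Scope R_scope.
Open Scope C_scope.

(* [ring] and [field] look up their structure on the type of the left-hand
   side, which is not syntactically [C] when a [sum_n_m] occurs there. *)
Ltac abstract_sums :=
  match goal with |- @eq _ ?a ?b => change (@eq C a b) end;
  repeat match goal with |- context [@sum_n_m C_AbelianMonoid ?a ?n ?m] =>
    let s := fresh "s" in
    generalize (@sum_n_m C_AbelianMonoid a n m); intro s; change C in s
  end;
  repeat match goal with |- context [@sum_n C_AbelianMonoid ?a ?n] =>
    let s := fresh "s" in
    generalize (@sum_n C_AbelianMonoid a n); intro s; change C in s
  end.
Ltac Cring := abstract_sums; ring.
Ltac Cfield := abstract_sums; field.

(** * Complex differentiation *)

(** Both structures on the codomain have the same operations and the same norm, and [is_derive]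
    consults nothing else there. The product and chain rules ask for [AbsRing_NormedModule]. *)
Lemma is_derive_C_ring (f : C -> C) (z l : C) :
  @is_derive C_AbsRing C_NormedModule f z l <->
  @is_derive C_AbsRing (AbsRing_NormedModule C_AbsRing) f z l.
Proof.
  split; intros [[H1 H2 H3] H4]; (split; [split|]); auto.
Qed.

Lemma is_C_derive_plus (f g : C -> C) (z a b : C) :
  is_derive f z a -> is_derive g z b ->
  is_derive (fun t => f t + g t) z (a + b).
Proof. exact (is_derive_plus (V := C_NormedModule) f g z a b). Qed.

Lemma is_C_derive_mult (f g : C -> C) (z a b : C) :
  is_derive f z a -> is_derive g z b ->
  is_derive (fun t => f t * g t) z (a * g z + f z * b).
Proof.
  intros Hf Hg. apply is_derive_C_ring.
  apply (is_derive_mult (K := C_AbsRing) f g z a b);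
    [now apply is_derive_C_ring | now apply is_derive_C_ring | exact Cmult_comm].
Qed.

Lemma is_C_derive_const (c z : C) : is_derive (fun _ : C => c) z (RtoC 0).
Proof. exact (is_derive_const (V := C_NormedModule) c z). Qed.

Lemma is_C_derive_id (z : C) : is_derive (fun t : C => t) z (RtoC 1).
Proof. apply is_derive_C_ring, (is_derive_id (K := C_AbsRing)). Qed.

Lemma is_C_derive_eq (f g : C -> C) (z a b : C) :
  (forall t, f t = g t) -> a = b -> is_derive f z a -> is_derive g z b.
Proof.
  intros Hfg -> Hf. now apply (is_derive_ext (V := C_NormedModule) f).
Qed.

Lemma is_C_derive_scal (f : C -> C) (c z a : C) :
  is_derive f z a -> is_derive (fun t => c * f t) z (c * a).
Proof.
  intros Hf. eapply is_C_derive_eq;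
    [ | | exact (is_C_derive_mult _ _ _ _ _ (is_C_derive_const c z) Hf)].
  - reflexivity.
  - simpl. Cring.
Qed.

Lemma is_C_derive_affine (f : C -> C) (c w z l : C) :
  is_derive f (c + z * w) l -> is_derive (fun t => f (c + t * w)) z (w * l).
Proof.
  intros Hf.
  apply (is_derive_comp (V := C_NormedModule) f (fun t => c + t * w) z l w);
    [exact Hf|].
  apply is_derive_C_ring. eapply is_C_derive_eq;
    [ | | exact (is_C_derive_plus _ _ _ _ _ (is_C_derive_const c z)
           (is_C_derive_scal _ w _ _ (is_C_derive_id z)))].
  - intros t. simpl. Cring.
  - Cring.
Qed.

Lemma is_C_derive_shift (f : C -> C) (c z l : C) :
  is_derive f (z + c) l -> is_derive (shift c f) z l.
Proof.
  intros Hf.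
  eapply is_C_derive_eq; [ | | apply (is_C_derive_affine f c 1 z l)].
  - intros t. unfold shift. f_equal. Cring.
  - Cring.
  - replace (c + z * 1) with (z + c) by Cring. exact Hf.
Qed.

Lemma is_C_derive_sum (g : nat -> C -> C) (d : nat -> C) (n : nat) (z : C) :
  (forall k, (1 <= k <= n)%nat -> is_derive (g k) z (d k)) ->
  is_derive (fun t => sum_n_m (fun k => g k t) 1 n) z (sum_n_m d 1 n).
Proof.
  induction n as [|n IH]; intros Hg.
  - rewrite sum_n_m_zero by lia. eapply is_C_derive_eq;
      [ | | exact (is_C_derive_const 0 z)]; [|reflexivity].
    intros t. now rewrite sum_n_m_zero by lia.
  - rewrite sum_n_Sm by lia. eapply is_C_derive_eq;
      [ | | apply (is_C_derive_plus _ _ _ _ _ (IH ltac:(intros; apply Hg; lia))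
             (Hg (S n) ltac:(lia)))]; [|reflexivity].
    intros t. now rewrite sum_n_Sm by lia.
Qed.

Lemma C_derive_spec (f : C -> C) (z : C) :
  ex_derive f z -> is_derive f z (C_derive f z).
Proof. intros H. now apply C_derive_correct. Qed.

Lemma is_C_derive_quotient (f : C -> C) (z l : C) :
  is_derive f z l ->
  filterlim (fun h => (f (z + h) - f z) / h) (locally' (RtoC 0)) (locally l).
Proof.
  intros [_ H]. specialize (H z (fun P HP => HP)).
  apply filterlim_locally. intros eps.
  assert (He : (0 < eps / 2)%R) by (destruct eps; simpl; lra).
  specialize (H (mkposreal _ He)). simpl in H.
  (* The derivative measures neighbourhoods by [Cmod], while [locally'] here uses balls taken
     coordinate by coordinate; [locally_C] passes between the two. *)
  apply locally_C in H. destruct H as [del Hd].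
  exists del. intros h Hh Hh0. change C in h.
  assert (Hb : ball z del (z + h)).
  { destruct z as [z1 z2], h as [h1 h2].
    destruct Hh as [B1 B2]. split; simpl in *.
    - unfold ball in *; simpl in *; unfold AbsRing_ball, abs, minus, plus, opp in *;
        simpl in *. replace (z1 + h1 + - z1)%R with (h1 + - 0)%R by ring. exact B1.
    - unfold ball in *; simpl in *; unfold AbsRing_ball, abs, minus, plus, opp in *;
        simpl in *. replace (z2 + h2 + - z2)%R with (h2 + - 0)%R by ring. exact B2. }
  specialize (Hd _ Hb). apply C_NormedModule_mixin_compat1.
  change (Cmod ((f (z + h) - f z) / h - l)%C < eps)%R.
  change (Cmod ((f (z + h) - f z) - (z + h - z) * l)%C
          <= eps / 2 * Cmod (z + h - z)%C)%R in Hd.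
  replace ((f (z + h) - f z) / h - l)
    with (((f (z + h) - f z) - (z + h - z) * l) / h) by (Cfield; exact Hh0).
  replace (z + h - z) with h in * by Cring.
  rewrite Cmod_div by exact Hh0.
  assert (Hp := proj1 (Cmod_gt_0 h) Hh0).
  (* Differentiability yields a weak inequality and the target ball is open, hence the choice of
     [eps / 2]. *)
  apply Rle_lt_trans with (eps / 2)%R; [|destruct eps; simpl; lra].
  apply Rle_div_l; [exact Hp|exact Hd].
Qed.

(** * Finite sums *)

Lemma sum_C_mult_l (c : C) (a : nat -> C) (n m : nat) :
  sum_n_m (fun k => c * a k) n m = c * sum_n_m a n m.
Proof. exact (sum_n_m_mult_l (K := C_Ring) c a n m). Qed.

Lemma sum_C_plus (a b : nat -> C) (n m : nat) :
  sum_n_m (fun k => a k + b k) n m = sum_n_m a n m + sum_n_m b n m.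
Proof. exact (sum_n_m_plus (G := C_AbelianMonoid) a b n m). Qed.

Lemma sum_C_S (a : nat -> C) (n : nat) :
  sum_n_m a 1 (S n) = sum_n_m a 1 n + a (S n).
Proof. apply (sum_n_Sm (G := C_AbelianMonoid)). lia. Qed.

Lemma sum_C_0 (a : nat -> C) : sum_n_m a 1 0 = RtoC 0.
Proof. apply (sum_n_m_zero (G := C_AbelianMonoid)). lia. Qed.

Lemma sum_R_S (a : nat -> R) (n : nat) :
  (sum_n_m a 1 (S n) = sum_n_m a 1 n + a (S n))%R.
Proof. apply (sum_n_Sm (G := R_AbelianMonoid)). lia. Qed.

Lemma sum_R_0 (a : nat -> R) : (sum_n_m a 1 0 = 0)%R.
Proof. apply (sum_n_m_zero (G := R_AbelianMonoid)). lia. Qed.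

(** * Finite-dimensional spaces of functions *)

Definition subspace (V : (C -> C) -> Prop) : Prop :=
  V (fun _ => 0) /\
  forall (g1 g2 : C -> C) (a b : C),
    V g1 -> V g2 -> V (fun z => a * g1 z + b * g2 z).

Lemma subspace_sum (V : (C -> C) -> Prop) (n : nat) (c : nat -> C)
    (g : nat -> C -> C) :
  subspace V -> (forall k, (1 <= k <= n)%nat -> V (g k)) ->
  V (fun z => sum_n_m (fun k => c k * g k z) 1 n).
Proof.
  intros [V0 VS]. induction n as [|n IH]; intros Hg.
  - replace (fun z => _) with (fun _ : C => RtoC 0); [exact V0|].
    apply functional_extensionality; intros z. now rewrite sum_C_0.
  - replace (fun z => _) with
      (fun z => 1 * sum_n_m (fun k => c k * g k z) 1 n + c (S n) * g (S n) z).
    + apply (VS (fun z => sum_n_m (fun k => c k * g k z) 1 n));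
        [apply IH; intros; apply Hg; lia | apply Hg; lia].
    + apply functional_extensionality; intros z. rewrite sum_C_S. Cring.
Qed.

(** This carries both finite dimension ([V] a span) and holomorphy ([V] the entire functions) from
    the translates of a function to their combinations. *)
Lemma lin_comb_min (X V : (C -> C) -> Prop) (g : C -> C) :
  subspace V -> (forall e, X e -> V e) -> lin_comb X g -> V g.
Proof.
  intros HV HX (n & c & e & He & Hg).
  replace g with (fun z => sum_n_m (fun k => c k * e k z) 1 n).
  - apply subspace_sum; auto.
  - apply functional_extensionality; intros z. now rewrite Hg.
Qed.

Lemma lin_comb_incl (X : (C -> C) -> Prop) (g : C -> C) : X g -> lin_comb X g.
Proof.
  intros Hg. exists 1%nat, (fun _ => RtoC 1), (fun _ => g). split; [auto|].
  intros z. rewrite sum_C_S, sum_C_0. Cring.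
Qed.

Lemma sum_C_append (a b : nat -> C) (n m : nat) :
  sum_n_m (fun k => if (k <=? n)%nat then a k else b (k - n)%nat) 1 (n + m)
  = sum_n_m a 1 n + sum_n_m b 1 m.
Proof.
  induction m as [|m IH].
  - rewrite Nat.add_0_r, (sum_C_0 b), Cplus_0_r.
    apply (sum_n_m_ext_loc (G := C_AbelianMonoid)). intros k Hk.
    now rewrite (proj2 (Nat.leb_le k n)) by lia.
  - rewrite Nat.add_succ_r, !sum_C_S, IH.
    rewrite (proj2 (Nat.leb_gt (S (n + m)) n)) by lia.
    replace (S (n + m) - n)%nat with (S m) by lia. Cring.
Qed.

Lemma lin_comb_subspace (X : (C -> C) -> Prop) : subspace (lin_comb X).
Proof.
  split.
  - exists 0%nat, (fun _ => RtoC 0), (fun _ _ => RtoC 0). split; [lia|].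
    intros z. now rewrite sum_C_0.
  - intros g1 g2 a b (n1 & c1 & e1 & H1 & E1) (n2 & c2 & e2 & H2 & E2).
    exists (n1 + n2)%nat,
      (fun k => if (k <=? n1)%nat then a * c1 k else b * c2 (k - n1)%nat),
      (fun k => if (k <=? n1)%nat then e1 k else e2 (k - n1)%nat).
    split.
    + intros k Hk. destruct (Nat.leb_spec k n1); [apply H1|apply H2]; lia.
    + intros z. rewrite E1, E2, <- !sum_C_mult_l, <- sum_C_append.
      apply (sum_n_m_ext (G := C_AbelianMonoid)). intros k.
      destruct (k <=? n1)%nat; apply Cmult_assoc.
Qed.

Lemma S_space_shift (X : (C -> C) -> Prop) (s : C) (g : C -> C) :
  S_space X g -> S_space X (shift s g).
Proof.
  intros (n & c & e & He & Hg).
  exists n, c, (fun k => shift s (e k)). split.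
  - intros k Hk. destruct (He k Hk) as (e0 & t & H0 & E0).
    exists e0, (s + t). split; [exact H0|].
    intros z. unfold shift. rewrite E0. f_equal. Cring.
  - intros z. unfold shift. apply Hg.
Qed.

(** Peeling off one generator at a time suits the induction on [l] in [interpolation], where the
    coefficient of the head is read off directly. *)
Fixpoint span (l : list (C -> C)) (g : C -> C) : Prop :=
  match l with
  | nil => forall z, g z = 0
  | e :: l' => exists c : C, span l' (fun z => g z - c * e z)
  end.

Lemma span_ext (l : list (C -> C)) (g1 g2 : C -> C) :
  (forall z, g1 z = g2 z) -> span l g1 -> span l g2.
Proof.
  intros H. apply functional_extensionality in H. subst g2.
  exact (fun H => H).
Qed.

Lemma span_subspace (l : list (C -> C)) : subspace (span l).
Proof.
  induction l as [|e l [IH0 IH]].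
  - split; [now intros z|]. simpl. intros g1 g2 a b H1 H2 z.
    rewrite H1, H2. Cring.
  - split.
    + exists (RtoC 0). apply (span_ext l (fun _ => 0)); [intros; Cring|exact IH0].
    + intros g1 g2 a b [c1 H1] [c2 H2]. exists (a * c1 + b * c2).
      eapply span_ext; [|apply (IH _ _ a b H1 H2)]. intros z. simpl. Cring.
Qed.

(** The list is reversed because [sum_n_m] splits off its last term whereas [span] peels off the
    head. *)
Lemma span_sum (e : nat -> C -> C) (c : nat -> C) (n : nat) :
  span (map e (rev (seq 1 n))) (fun z => sum_n_m (fun k => c k * e k z) 1 n).
Proof.
  induction n as [|n IH].
  - intros z. apply sum_C_0.
  - rewrite seq_S, rev_app_distr. simpl. exists (c (S n)).
    eapply span_ext; [|exact IH]. intros z. simpl. rewrite sum_C_S. Cring.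
Qed.

(* If [V] is not already contained in [span l], pick [r0] in [V] outside of it
   and subtract its interpolation on the old nodes: the difference [r] is not
   identically zero, and a point where it does not vanish is the new node. *)
Lemma interpolation (l : list (C -> C)) :
  forall V : (C -> C) -> Prop,
  subspace V -> (forall g, V g -> span l g) ->
  exists (d : nat) (x : nat -> C) (b : nat -> C -> C),
    (forall j, (1 <= j <= d)%nat -> V (b j)) /\
    (forall g, V g -> forall z, g z = sum_n_m (fun j => g (x j) * b j z) 1 d).
Proof.
  induction l as [|e l IH]; intros V HV Hl.
  { exists 0%nat, (fun _ => RtoC 0), (fun _ _ => RtoC 0). split; [lia|].
    intros g Hg z. rewrite sum_C_0. now apply Hl. }
  destruct (classic (exists r0, V r0 /\ ~ span l r0)) as [(r0 & Vr0 & Nr0)|N].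
  2:{ apply IH; [exact HV|]. intros g Hg.
      destruct (classic (span l g)) as [H|H]; [exact H|].
      destruct N. now exists g. }
  destruct (span_subspace l) as [S0 SS]. destruct HV as [V0 VS].
  (* The old nodes interpolate the part of [V] that lies in [span l]. *)
  destruct (IH (fun g => V g /\ span l g)) as (d & x & b & Hb & Hi).
  { split; [now split|]. intros g1 g2 a c [] []. split; auto. }
  { tauto. }
  set (p := fun z => sum_n_m (fun j => r0 (x j) * b j z) 1 d).
  assert (Hp : V p /\ span l p).
  { split; apply subspace_sum; try (split; assumption); apply Hb. }
  set (r := fun z => 1 * r0 z + - (1) * p z).
  assert (Vr : V r) by (apply VS; tauto).
  destruct (classic (forall z, r z = 0)) as [Hr|Hr].
  { destruct Nr0. apply (span_ext l p); [|tauto].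
    intros z. specialize (Hr z). unfold r in Hr.
    replace (p z) with (r0 z - (1 * r0 z + - (1) * p z)) by Cring.
    rewrite Hr. Cring. }
  apply not_all_ex_not in Hr. destruct Hr as [xs Hxs].
  destruct (Hl r0 Vr0) as [c0 Hc0].
  (* [c0] is the coefficient of [r0] along [e]; were it zero, [r0] would lie in [span l]. *)
  assert (Nc0 : c0 <> 0).
  { intros ->. apply Nr0. eapply span_ext; [|exact Hc0]. intros; simpl; Cring. }
  set (rho := fun z => r z / r xs).
  (* [rho] takes the value 1 at the new node [xs], and each old [b j] is corrected by a multiple of
     [r] so that it vanishes there. *)
  exists (S d), (fun j => if (j =? S d)%nat then xs else x j),
    (fun j => if (j =? S d)%nat then rho
              else fun z => 1 * b j z + - (b j xs / r xs) * r z).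
  split.
  { intros j Hj. destruct (Nat.eqb_spec j (S d)).
    - replace rho with (fun z => (/ r xs) * r z + 0 * r z).
      + now apply VS.
      + apply functional_extensionality; intros z. unfold rho, Cdiv. Cring.
    - apply VS; [apply Hb; lia|exact Vr]. }
  intros g Vg.
  destruct (Hl g Vg) as [c Hc].
  (* With this factor the coefficients along [e] cancel in [g - al * r0], so the old nodes
     interpolate that difference. *)
  set (al := c / c0).
  assert (Hg' : V (fun z => 1 * g z + - al * r0 z) /\
                span l (fun z => 1 * g z + - al * r0 z)).
  { split; [now apply VS|].
    eapply span_ext; [|apply (SS _ _ 1 (- al) Hc Hc0)].
    intros z. simpl. unfold al. Cfield. exact Nc0. }
  assert (G : forall z, g z = al * r z + sum_n_m (fun j => g (x j) * b j z) 1 d).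
  { intros z. generalize (Hi _ Hg' z). simpl.
    replace (sum_n_m (fun j => (1 * g (x j) + - al * r0 (x j)) * b j z) 1 d)
      with (sum_n_m (fun j => g (x j) * b j z) 1 d + - al * p z).
    - unfold r. intros E.
      replace (g z) with (1 * g z + - al * r0 z + al * r0 z) by Cring.
      rewrite E. Cring.
    - unfold p. rewrite <- sum_C_mult_l, <- sum_C_plus.
      apply (sum_n_m_ext (G := C_AbelianMonoid)). intros j.
      simpl. Cring. }
  (* Evaluating [G] at [xs], where [r] is nonzero, expresses [al] through values of [g] at nodes
     only. *)
  assert (Hal : al = (g xs - sum_n_m (fun j => g (x j) * b j xs) 1 d) / r xs).
  { rewrite (G xs) at 1. Cfield. exact Hxs. }
  intros z. rewrite sum_C_S, Nat.eqb_refl.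
  rewrite (sum_n_m_ext_loc (G := C_AbelianMonoid) _
    (fun j => g (x j) * b j z + - rho z * (g (x j) * b j xs))).
  2:{ intros j Hj. rewrite (proj2 (Nat.eqb_neq j (S d))) by lia.
      unfold rho. change plus with Cplus. Cfield. exact Hxs. }
  rewrite sum_C_plus, sum_C_mult_l, (G z), Hal. unfold rho. Cfield. exact Hxs.
Qed.

(** * Exponential type of functions with finite-dimensional translation span *)

Lemma entire_subspace : subspace entire.
Proof.
  split.
  - intros z. exists (RtoC 0). apply is_C_derive_const.
  - intros g1 g2 a b H1 H2 z.
    destruct (H1 z) as [d1 D1], (H2 z) as [d2 D2].
    exists (a * d1 + b * d2).
    apply is_C_derive_plus; now apply is_C_derive_scal.
Qed.

Lemma entire_shift (c : C) (g : C -> C) : entire g -> entire (shift c g).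
Proof.
  intros H z. destruct (H (z + c)) as [l Hl]. exists l.
  now apply is_C_derive_shift.
Qed.

(** Interpolation is applied to the span of all translates of [F], so nodes and [b j] do not depend
    on [h]; the value of [shift h F] at the node [x j] is [F (x j + h)]. The [b j] are entire as
    combinations of translates. *)
Lemma translates_separated (F : C -> C) (l : list (C -> C)) :
  entire F -> (forall h, span l (shift h F)) ->
  exists (d : nat) (x : nat -> C) (b : nat -> C -> C),
    (forall j, (1 <= j <= d)%nat -> entire (b j)) /\
    (forall z h, F (z + h) = sum_n_m (fun j => F (x j + h) * b j z) 1 d).
Proof.
  intros HF Hl.
  assert (HT : forall (V : (C -> C) -> Prop) e, (forall h, V (shift h F)) ->
            translates (fun g => g = F) e -> V e).
  { intros V e HV (g & c & -> & He).
    now rewrite (functional_extensionality e (shift c F) He). }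
  destruct (interpolation l (S_space (fun g => g = F))) as (d & x & b & Hb & Hi).
  - apply lin_comb_subspace.
  - intros g. apply lin_comb_min; [apply span_subspace|].
    intros e. now apply HT.
  - exists d, x, b. split.
    + intros j Hj. apply (lin_comb_min (translates (fun g => g = F)));
        [apply entire_subspace| |now apply Hb].
      intros e. apply HT. intros h. now apply entire_shift.
    + intros z h. apply (Hi (shift h F)).
      apply lin_comb_incl. now exists F, h.
Qed.

Lemma sum_R_ge_0 (a : nat -> R) (n : nat) :
  (forall k, 0 <= a k)%R -> (0 <= sum_n_m a 1 n)%R.
Proof.
  intros Ha. induction n as [|n IH]; [rewrite sum_R_0; lra|].
  rewrite sum_R_S. specialize (Ha (S n)). lra.
Qed.

Lemma Cmod_sum_mult_le (a c : nat -> C) (n : nat) :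
  (Cmod (sum_n_m (fun k => a k * c k)%C 1 n)
   <= sum_n_m (fun k => Cmod (c k)) 1 n * sum_n_m (fun k => Cmod (a k)) 1 n)%R.
Proof.
  induction n as [|n IH].
  - rewrite sum_C_0, !sum_R_0, Cmod_0. lra.
  - rewrite sum_C_S, !sum_R_S.
    eapply Rle_trans; [apply Cmod_triangle|]. rewrite Cmod_mult.
    pose proof (sum_R_ge_0 (fun k => Cmod (a k)) n (fun k => Cmod_ge_0 _)).
    pose proof (sum_R_ge_0 (fun k => Cmod (c k)) n (fun k => Cmod_ge_0 _)).
    pose proof (Cmod_ge_0 (a (S n))). pose proof (Cmod_ge_0 (c (S n))).
    nra.
Qed.

Lemma sum_R_le (a b : nat -> R) (n : nat) :
  (forall k, (1 <= k <= n)%nat -> (a k <= b k)%R) ->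
  (sum_n_m a 1 n <= sum_n_m b 1 n)%R.
Proof.
  induction n as [|n IH]; intros H.
  - rewrite !sum_R_0. lra.
  - rewrite !sum_R_S. apply Rplus_le_compat; [apply IH; intros|]; apply H; lia.
Qed.

Lemma sum_R_mult_r (c : R) (a : nat -> R) (n m : nat) :
  (sum_n_m (fun k => a k * c) n m = sum_n_m a n m * c)%R.
Proof. exact (sum_n_m_mult_r (K := R_Ring) c a n m). Qed.

Section Derivatives.

Variables (F : C -> C) (d : nat) (x : nat -> C) (b : nat -> C -> C).
Hypothesis Hb : forall j, (1 <= j <= d)%nat -> entire (b j).
Hypothesis HF : forall z h,
  F (z + h) = sum_n_m (fun j => F (x j + h) * b j z) 1 d.

(** The separated formula can be differentiated in either variable. In [h] it reproduces itself for
    the next derivative, which drives the induction; in [z] it gives differentiability and the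
    formula with the derivatives of the [b j]. *)
Lemma separated_derive_n (k : nat) :
  (forall z h, C_derive_n F k (z + h)
     = sum_n_m (fun j => C_derive_n F k (x j + h) * b j z) 1 d) /\
  (forall z, is_derive (C_derive_n F k) z (C_derive_n F (S k) z)) /\
  (forall z h, C_derive_n F (S k) (z + h)
     = sum_n_m (fun j => C_derive_n F k (x j + h) * C_derive (b j) z) 1 d).
Proof.
  (* For fixed [h] the right-hand side is a finite combination of the entire functions [b j] of
     [z]. *)
  assert (Hstep : forall g : C -> C,
    (forall z h, g (z + h) = sum_n_m (fun j => g (x j + h) * b j z) 1 d) ->
    forall z h, is_derive g (z + h)
      (sum_n_m (fun j => g (x j + h) * C_derive (b j) z) 1 d)).
  { intros g Hg z h.
    replace g with (shift (- h) (fun t => g (t + h))) at 1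
      by (apply functional_extensionality; intros t; unfold shift; f_equal; ring).
    apply is_C_derive_shift. replace (z + h + - h) with z by ring.
    eapply is_C_derive_eq;
      [ | reflexivity
        | apply (is_C_derive_sum (fun j t => g (x j + h) * b j t))].
    - intros t. symmetry. apply Hg.
    - intros j Hj. apply is_C_derive_scal, C_derive_spec, Hb, Hj. }
  assert (HD : forall g : C -> C,
    (forall z h, g (z + h) = sum_n_m (fun j => g (x j + h) * b j z) 1 d) ->
    (forall z, is_derive g z (C_derive g z)) /\
    (forall z h, C_derive g (z + h)
       = sum_n_m (fun j => g (x j + h) * C_derive (b j) z) 1 d)).
  { intros g Hg. split.
    - intros z. change C in z. apply C_derive_spec.
      generalize (Hstep g Hg z 0). rewrite Cplus_0_r. intros H.
      eexists. exact H.
    - intros z h. apply is_C_derive_unique. now apply Hstep. }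
  assert (HP : forall z h, C_derive_n F k (z + h)
     = sum_n_m (fun j => C_derive_n F k (x j + h) * b j z) 1 d).
  { induction k as [|k IH]; [exact HF|].
    destruct (HD _ IH) as [D1 _]. intros z h.
    clear - D1 IH.
    change (C_derive_n F (S k)) with (C_derive (C_derive_n F k)).
    generalize dependent (C_derive_n F k). intros g Hg D1.
    assert (DS : forall c t, is_derive (fun s => g (c + s)) t (C_derive g (c + t))).
    { intros c t. change C in t.
      apply (is_C_derive_eq (shift c g) _ t (C_derive g (c + t)));
        [intros s; unfold shift; f_equal; ring | reflexivity |].
      apply is_C_derive_shift. rewrite Cplus_comm. apply D1. }
    (* The derivative of [s |-> g (z + s)] at [h] is now computed a second time from the separated
       formula, with the [b j z] as constants. *)
    rewrite <- (is_C_derive_unique _ _ _ (DS z h)).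
    apply is_C_derive_unique.
    eapply is_C_derive_eq;
      [ | | apply (is_C_derive_sum (fun j s => b j z * g (x j + s))
            (fun j => b j z * C_derive g (x j + h)))].
    - intros t. rewrite Hg. apply (sum_n_m_ext (G := C_AbelianMonoid)).
      intros j. apply Cmult_comm.
    - apply (sum_n_m_ext (G := C_AbelianMonoid)). intros j. apply Cmult_comm.
    - intros j _. apply is_C_derive_scal, DS. }
  split; [exact HP|]. exact (HD _ HP).
Qed.

(** The sum over the nodes of [Cmod (C_derive_n F k (x i + z))] grows by at most the factor [M] from
    [k] to [k + 1], where [M] is the sum of all moduli of entries of the matrix
    [C_derive (b j) (x i)]. The constant [beta] then passes from the nodes to [z] itself. *)
Lemma separated_derive_n_bound : exists beta M : R, (0 <= beta)%R /\ (0 <= M)%R /\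
  forall k z, (Cmod (C_derive_n F k z)
    <= beta * M ^ k * sum_n_m (fun j => Cmod (F (x j + z))) 1 d)%R.
Proof.
  set (beta := sum_n_m (fun j => Cmod (b j 0)) 1 d : R).
  set (m := fun i => sum_n_m (fun j => Cmod (C_derive (b j) (x i))) 1 d : R).
  set (M := sum_n_m m 1 d : R).
  assert (Hbeta : (0 <= beta)%R) by (apply sum_R_ge_0; intros; apply Cmod_ge_0).
  assert (HM : (0 <= M)%R).
  { apply sum_R_ge_0. intros i. apply sum_R_ge_0. intros; apply Cmod_ge_0. }
  exists beta, M. split; [exact Hbeta|]. split; [exact HM|].
  intros k z.
  assert (N : (sum_n_m (fun i => Cmod (C_derive_n F k (x i + z))) 1 d
               <= M ^ k * sum_n_m (fun j => Cmod (F (x j + z))) 1 d)%R).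
  { induction k as [|k IH]; [simpl; lra|].
    eapply Rle_trans.
    - apply sum_R_le. intros i _.
      rewrite (proj2 (proj2 (separated_derive_n k)) (x i) z).
      apply Cmod_sum_mult_le.
    - rewrite (sum_R_mult_r _ m). fold M. simpl. rewrite Rmult_assoc.
      now apply Rmult_le_compat_l. }
  (* Expanding at base point 0 makes the coefficients [b j 0] independent of [z]. *)
  replace z with (0 + z) at 1 by ring.
  rewrite (proj1 (separated_derive_n k) 0 z).
  eapply Rle_trans; [apply Cmod_sum_mult_le|]. fold beta.
  rewrite Rmult_assoc. now apply Rmult_le_compat_l.
Qed.

End Derivatives.

(** * Estimates along real segments *)

Lemma Rabs_Re_Im_le_Cmod (z : C) :
  (Rabs (Re z) <= Cmod z)%R /\ (Rabs (Im z) <= Cmod z)%R.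
Proof.
  pose proof (Rmax_Cmod z) as H.
  split; (eapply Rle_trans; [|exact H]); [apply Rmax_l|apply Rmax_r].
Qed.

(** The embedding [RtoC] is isometric, so the first-order estimate for [g] restricts to real
    increments; taking real or imaginary parts can only decrease the error. *)
Lemma is_derive_Re_Im_line (g : C -> C) (t : R) (l : C) :
  is_derive g (RtoC t) l ->
  is_derive (fun s : R => Re (g (RtoC s))) t (Re l) /\
  is_derive (fun s : R => Im (g (RtoC s))) t (Im l).
Proof.
  intros [_ H]. specialize (H _ (fun P HP => HP)).
  assert (K : forall eps : posreal, locally t (fun s : R =>
    Cmod (g (RtoC s) - g (RtoC t) - (RtoC s - RtoC t) * l)%C
      <= eps * Rabs (s - t))%R).
  { intros eps. destruct (H eps) as [del Hd]. exists del. intros s Hs.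
    specialize (Hd (RtoC s)).
    replace (Rabs (s - t)) with (Cmod (RtoC s - RtoC t)%C).
    - apply Hd. unfold ball; simpl; unfold AbsRing_ball.
      change (Cmod (RtoC s - RtoC t)%C < del)%R.
      rewrite <- RtoC_minus, Cmod_R. exact Hs.
    - now rewrite <- RtoC_minus, Cmod_R. }
  split; (split; [apply is_linear_scal_l|]); intros y Hy;
    apply (is_filter_lim_locally_unique (V := AbsRing_NormedModule R_AbsRing)) in Hy;
    subst y; intros eps;
    (eapply filter_imp; [|apply (K eps)]); intros s Hs; simpl in Hs |- *;
    (eapply Rle_trans; [|exact Hs]).
  - eapply Rle_trans; [|apply (proj1 (Rabs_Re_Im_le_Cmod _))]. right.
    change (Rabs ((Re (g (RtoC s)) - Re (g (RtoC t))) - (s - t) * Re l)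
      = Rabs (Re (g (RtoC s) - g (RtoC t) - (RtoC s - RtoC t) * l)%C))%R.
    f_equal. unfold Re. simpl. ring.
  - eapply Rle_trans; [|apply (proj2 (Rabs_Re_Im_le_Cmod _))]. right.
    change (Rabs ((Im (g (RtoC s)) - Im (g (RtoC t))) - (s - t) * Im l)
      = Rabs (Im (g (RtoC s) - g (RtoC t) - (RtoC s - RtoC t) * l)%C))%R.
    f_equal. unfold Im. simpl. ring.
Qed.

Lemma Cmod_le_Re_Im (z : C) : (Cmod z <= Rabs (Re z) + Rabs (Im z))%R.
Proof.
  destruct z as [p q].
  replace (p, q) with (RtoC p + Ci * RtoC q)
    by (unfold Ci; apply injective_projections; simpl; ring).
  eapply Rle_trans; [apply Cmod_triangle|].
  rewrite Cmod_mult, Cmod_Ci, !Cmod_R. simpl. right.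
  replace (p + (0 * q - 1 * 0))%R with p by ring.
  replace (0 + (0 * 0 + 1 * q))%R with q by ring. ring.
Qed.

(** The real inequality is applied to real and imaginary parts separately, which costs the factor 2.
    The range of [t] is the one that [bounded_variation] asks for: all points at distance at most 1
    from 0. *)
Lemma C_mean_value (g dg : C -> C) (K : R) :
  (forall t : R, (Rabs t <= 1)%R ->
     is_derive g (RtoC t) (dg (RtoC t)) /\ (Cmod (dg (RtoC t)) <= K)%R) ->
  (Cmod (g 1 - g 0)%C <= 2 * K)%R.
Proof.
  intros H.
  assert (B1 := bounded_variation (fun s => Re (g (RtoC s)))
    (fun s => Re (dg (RtoC s))) K 0 1).
  assert (B2 := bounded_variation (fun s => Im (g (RtoC s)))
    (fun s => Im (dg (RtoC s))) K 0 1).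
  simpl in B1, B2.
  replace (1 - 0)%R with 1%R in B1, B2 by ring. rewrite Rabs_R1 in B1, B2.
  eapply Rle_trans; [apply Cmod_le_Re_Im|].
  replace (2 * K)%R with (K * 1 + K * 1)%R by ring.
  apply Rplus_le_compat; [apply B1|apply B2]; intros t Ht;
    rewrite Rminus_0_r in Ht; destruct (H t Ht) as [D L];
    destruct (is_derive_Re_Im_line _ _ _ D); (split; [assumption|]);
    (eapply Rle_trans; [apply Rabs_Re_Im_le_Cmod|exact L]).
Qed.

(** Real and imaginary parts are continuous along the line, and the extreme value theorem applies to
    each on [-1, 1]. *)
Lemma entire_bounded_segment (g : C -> C) (c w : C) : entire g ->
  exists B : R, forall t : R, (Rabs t <= 1)%R -> (Cmod (g (c + RtoC t * w)%C) <= B)%R.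
Proof.
  intros Hg.
  assert (D : forall t : R, exists l, is_derive (fun z => g (c + z * w)) (RtoC t) l).
  { intros t. destruct (Hg (c + RtoC t * w)) as [l Hl].
    exists (w * l). now apply is_C_derive_affine. }
  assert (R1 : forall r : R -> R, (forall t, ex_derive r t) ->
    exists B, forall t, (Rabs t <= 1)%R -> (Rabs (r t) <= B)%R).
  { intros r Hr.
    destruct (continuity_ab_maj (fun t => Rabs (r t)) (-1) 1) as (t0 & Ht0 & _).
    - lra.
    - intros t _. apply (continuity_pt_comp r Rabs); [|apply Rcontinuity_abs].
      apply continuity_pt_filterlim.
      exact (ex_derive_continuous (V := R_NormedModule) r t (Hr t)).
    - exists (Rabs (r t0)). intros t Ht. apply Ht0. now apply Rabs_le_between. }
  destruct (R1 (fun t => Re (g (c + RtoC t * w)))) as [B1 H1].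
  { intros t. destruct (D t) as [l Hl]. exists (Re l).
    apply (is_derive_Re_Im_line (fun z => g (c + z * w))), Hl. }
  destruct (R1 (fun t => Im (g (c + RtoC t * w)))) as [B2 H2].
  { intros t. destruct (D t) as [l Hl]. exists (Im l).
    apply (is_derive_Re_Im_line (fun z => g (c + z * w))), Hl. }
  exists (B1 + B2)%R. intros t Ht. eapply Rle_trans; [apply Cmod_le_Re_Im|].
  apply Rplus_le_compat; auto.
Qed.

(** * Taylor expansion *)

Lemma NtoC_fact_neq_0 (n : nat) : NtoC (fact n) <> 0.
Proof. intros H. apply RtoC_inj in H. exact (INR_fact_neq_0 n H). Qed.

Lemma NtoC_fact_S (n : nat) : NtoC (fact (S n)) = NtoC (S n) * NtoC (fact n).
Proof. unfold NtoC. now rewrite fact_simpl, mult_INR, RtoC_mult. Qed.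

Lemma NtoC_S (n : nat) : NtoC (S n) = NtoC n + 1.
Proof. unfold NtoC. now rewrite S_INR, RtoC_plus. Qed.

Lemma is_C_derive_pow_1_minus (n : nat) (z : C) :
  is_derive (fun t => (1 - t) ^ S n) z (- NtoC (S n) * (1 - z) ^ n).
Proof.
  assert (H1 : is_derive (fun t : C => 1 - t) z (- (1))).
  { eapply is_C_derive_eq;
      [ | | exact (is_C_derive_plus _ _ _ _ _ (is_C_derive_const 1 z)
             (is_C_derive_scal _ (- (1)) _ _ (is_C_derive_id z)))];
      [intros t; simpl; ring | ring]. }
  induction n as [|n IH].
  - eapply is_C_derive_eq; [ | | exact H1].
    + intros t. simpl. Cring.
    + unfold NtoC. simpl. Cring.
  - eapply is_C_derive_eq; [ | | exact (is_C_derive_mult _ _ _ _ _ H1 IH)].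
    + intros t. simpl. Cring.
    + rewrite (NtoC_S (S n)). simpl. Cring.
Qed.

(* As a function of the base point, the Taylor polynomial of fixed evaluation
   point [y + w] has a telescoping derivative. *)
Lemma is_C_derive_taylor_poly (D : nat -> C -> C) (y w : C) (K : nat) (z : C) :
  (forall k z, is_derive (D k) z (D (S k) z)) ->
  is_derive (fun t => sum_n (fun k =>
      D k (y + t * w) * (w ^ k / NtoC (fact k) * (1 - t) ^ k)) K) z
    (D (S K) (y + z * w) * (w ^ S K / NtoC (fact K) * (1 - z) ^ K)).
Proof.
  intros HD.
  assert (HDw : forall k, is_derive (fun t => D k (y + t * w)) z
                  (w * D (S k) (y + z * w))).
  { intros k. apply is_C_derive_affine, HD. }
  induction K as [|K IH].
  - eapply is_C_derive_eq; [ | | exact (HDw 0%nat)].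
    + intros t. rewrite sum_O. unfold NtoC. simpl. Cfield.
    + unfold NtoC. simpl. Cfield.
  (* Differentiating [(1 - t) ^ S K] in the new term cancels the remainder left by [IH], since
     (K+1)/(K+1)! = 1/K!. *)
  - eapply is_C_derive_eq;
      [ | | exact (is_C_derive_plus _ _ _ _ _ IH
              (is_C_derive_mult _ _ _ _ _ (HDw (S K))
                 (is_C_derive_scal _ (w ^ S K / NtoC (fact (S K))) _ _
                    (is_C_derive_pow_1_minus K z))))].
    + intros t. simpl. now rewrite sum_Sn.
    + rewrite NtoC_fact_S. simpl. Cfield.
      split; [apply NtoC_fact_neq_0|].
      intros H. apply RtoC_inj in H. now apply (not_0_INR (S K)).
Qed.

(** Moving the base point from [y] to [y + w] turns the Taylor polynomial into the exact value
    [D 0 (y + w)]. The mean value inequality bounds the total change, and the factorial beats the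
    geometric growth. *)
Lemma taylor_series (D : nat -> C -> C) (y w : C) (A M : R) :
  (forall k z, is_derive (D k) z (D (S k) z)) ->
  (forall k (t : R), (Rabs t <= 1)%R ->
     (Cmod (D k (y + RtoC t * w)%C) <= A * M ^ k)%R) ->
  is_series (fun k => D k y * (w ^ k / NtoC (fact k))) (D 0%nat (y + w)).
Proof.
  intros HD HB.
  set (phi := fun K t => sum_n (fun k =>
      D k (y + t * w) * (w ^ k / NtoC (fact k) * (1 - t) ^ k)) K : C).
  assert (E1 : forall K, phi K 1 = D 0%nat (y + w)).
  { unfold phi. induction K as [|K IH].
    - rewrite sum_O. rewrite Cmult_1_l. unfold NtoC. simpl. Cfield.
    - rewrite sum_Sn, IH. change plus with Cplus. simpl Cpow.
      replace (1 - 1) with (RtoC 0) by ring. Cring. }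
  assert (E0 : forall K, phi K 0 = sum_n (fun k => D k y * (w ^ k / NtoC (fact k))) K).
  { intros K. apply (sum_n_ext (G := C_AbelianMonoid)). intros k.
    replace (1 - 0) with (RtoC 1) by ring. rewrite Cpow_1_l, Cmult_0_l, Cplus_0_r.
    Cring. }
  assert (E : forall K, (Cmod (phi K 1 - phi K 0)%C <=
    2 * A * M * Cmod w * ((2 * M * Cmod w) ^ K / INR (fact K)))%R).
  { intros K.
    (* The leading 2 comes from [C_mean_value]; [2 ^ K] bounds the modulus of [(1 - t) ^ K], as [t]
       ranges over [-1, 1]. *)
    replace (2 * A * M * Cmod w * ((2 * M * Cmod w) ^ K / INR (fact K)))%R
      with (2 * (A * M ^ S K * (Cmod w ^ S K / INR (fact K) * 2 ^ K)))%R.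
    2:{ rewrite !Rpow_mult_distr. simpl. field. apply INR_fact_neq_0. }
    apply C_mean_value with (dg := fun z =>
      D (S K) (y + z * w) * (w ^ S K / NtoC (fact K) * (1 - z) ^ K)).
    intros t Ht. split; [now apply is_C_derive_taylor_poly|].
    rewrite !Cmod_mult, Cmod_div, !Cmod_pow by apply NtoC_fact_neq_0.
    assert (F0 : (0 < INR (fact K))%R) by apply INR_fact_lt_0.
    unfold NtoC. rewrite Cmod_R, (Rabs_pos_eq (INR _)) by lra.
    assert (W : (0 <= Cmod w ^ S K / INR (fact K))%R).
    { apply Rdiv_le_0_compat; [apply pow_le, Cmod_ge_0|exact F0]. }
    apply Rmult_le_compat; [apply Cmod_ge_0| |now apply HB|].
    - apply Rmult_le_pos; [exact W|apply pow_le, Cmod_ge_0].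
    - apply Rmult_le_compat_l; [exact W|]. apply pow_incr.
      split; [apply Cmod_ge_0|].
      rewrite <- RtoC_minus, Cmod_R. apply Rabs_le_between in Ht.
      apply Rabs_le. lra. }
  apply filterlim_locally. intros eps.
  pose proof (cv_speed_pow_fact (2 * M * Cmod w)) as L.
  apply is_lim_seq_Reals in L.
  apply (is_lim_seq_scal_l _ (2 * A * M * Cmod w)%R) in L.
  simpl in L. rewrite Rmult_0_r in L.
  apply is_lim_seq_Reals in L.
  destruct (L eps (cond_pos eps)) as [N HN].
  exists N. intros K HK. apply C_NormedModule_mixin_compat1.
  rewrite <- E0, <- (E1 K).
  change (Cmod (phi K 0 - phi K 1)%C < eps)%R.
  rewrite <- Cmod_opp. replace (- (phi K 0 - phi K 1)) with (phi K 1 - phi K 0) by ring.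
  eapply Rle_lt_trans; [apply E|].
  specialize (HN K HK). unfold R_dist in HN. rewrite Rminus_0_r in HN.
  eapply Rle_lt_trans; [apply Rle_abs|exact HN].
Qed.

Lemma finite_type_derive (F : C -> C) (l : list (C -> C)) :
  entire F -> (forall h, span l (shift h F)) ->
  (forall k z, is_derive (C_derive_n F k) z (C_derive_n F (S k) z)) /\
  (forall y w, is_series
     (fun k => C_derive_n F k y * (w ^ k / NtoC (fact k))) (F (y + w))).
Proof.
  intros HF Hl.
  destruct (translates_separated F l HF Hl) as (d & x & b & Hb & Hs).
  assert (HD : forall k z, is_derive (C_derive_n F k) z (C_derive_n F (S k) z)).
  { intros k. apply (separated_derive_n F d x b Hb Hs k). }
  split; [exact HD|]. intros y w.
  destruct (separated_derive_n_bound F d x b Hb Hs) as (beta & M & Pb & PM & HB).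
  assert (HN : exists B : R, forall t : R, (Rabs t <= 1)%R ->
    (sum_n_m (fun j => Cmod (F (x j + (y + RtoC t * w))%C)) 1 d <= B)%R).
  { clear - HF. induction d as [|d [B IH]].
    - exists 0%R. intros t _. rewrite sum_R_0. lra.
    - destruct (entire_bounded_segment F (x (S d) + y) w HF) as [B' HB'].
      exists (B + B')%R. intros t Ht. rewrite sum_R_S.
      apply Rplus_le_compat; [now apply IH|].
      rewrite Cplus_assoc. now apply HB'. }
  destruct HN as [B HN].
  apply (taylor_series (C_derive_n F) y w (beta * B) M); [exact HD|].
  intros k t Ht. eapply Rle_trans; [apply HB|].
  replace (beta * B * M ^ k)%R with (beta * M ^ k * B)%R by ring.
  apply Rmult_le_compat_l; [|now apply HN].
  apply Rmult_le_pos; [exact Pb|now apply pow_le].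
Qed.

(** * Fractional sums *)

Lemma filterlim_C_plus (a b : C -> C) (la lb : C) :
  filterlim a (locally' (RtoC 0)) (locally la) ->
  filterlim b (locally' (RtoC 0)) (locally lb) ->
  filterlim (fun h => a h + b h) (locally' (RtoC 0)) (locally (la + lb)).
Proof.
  intros Ha Hb.
  refine (filterlim_comp_2 _ _ (fun p q => p + q) Ha Hb _).
  exact (filterlim_plus (V := C_NormedModule) la lb).
Qed.

Lemma filterlim_C_scal (a : C -> C) (c la : C) :
  filterlim a (locally' (RtoC 0)) (locally la) ->
  filterlim (fun h => c * a h) (locally' (RtoC 0)) (locally (c * la)).
Proof.
  intros Ha.
  exact (filterlim_comp _ _ _ _ _ _ _ _ Ha
           (filterlim_scal_r (V := C_NormedModule) c la)).
Qed.

Lemma filterlim_C_ext (a b : C -> C) (la lb : C) :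
  (forall h : C, h <> 0 -> a h = b h) -> la = lb ->
  filterlim a (locally' (RtoC 0)) (locally la) ->
  filterlim b (locally' (RtoC 0)) (locally lb).
Proof.
  intros Hab ->. apply filterlim_ext_loc.
  exists (mkposreal 1 Rlt_0_1). intros h _. apply Hab.
Qed.

(** Applied below both to values of the [w m] and to values of their fractional sums. *)
Lemma filterlim_negligible_sum (n : nat) (v : nat -> C -> C) (c : nat -> C) :
  (forall m, (1 <= m <= n)%nat ->
     filterlim (fun h => v m h / h) (locally' (RtoC 0)) (locally (RtoC 0))) ->
  filterlim (fun h => sum_n_m (fun m => v m h * c m) 1 n / h)
    (locally' (RtoC 0)) (locally (RtoC 0)).
Proof.
  induction n as [|n IH]; intros Hv.
  - eapply filterlim_C_ext; [|reflexivity|apply filterlim_const].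
    intros h Hh. simpl. rewrite sum_C_0. Cfield. exact Hh.
  - eapply filterlim_C_ext;
      [| |exact (filterlim_C_plus _ _ _ _ (IH ltac:(intros; apply Hv; lia))
              (filterlim_C_scal _ (c (S n)) _ (Hv (S n) ltac:(lia))))].
    + intros h Hh. simpl. rewrite sum_C_S. Cfield. exact Hh.
    + ring.
Qed.

Section FractionalSum.

Variables (U : (C -> C) -> Prop) (Sigma : (C -> C) -> C -> C -> C).
Hypothesis ax : frac_sum_axioms U Sigma.

Let SU : subspace (S_space U) := lin_comb_subspace (translates U).

Lemma Sigma_zero (x y : C) : Sigma (fun _ => 0) x y = 0.
Proof.
  generalize (frac_sum_A3 _ _ ax (fun _ => 0) (fun _ => 0) x y 0 0 (proj1 SU) (proj1 SU)).
  replace (fun _ : C => 0 * 0 + 0 * 0) with (fun _ : C => RtoC 0)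
    by (apply functional_extensionality; intros; ring).
  intros ->. ring.
Qed.

Lemma Sigma_sum (n : nat) (c : nat -> C) (g : nat -> C -> C) (x y : C) :
  (forall k, (1 <= k <= n)%nat -> S_space U (g k)) ->
  Sigma (fun t => sum_n_m (fun k => c k * g k t) 1 n) x y
  = sum_n_m (fun k => c k * Sigma (g k) x y) 1 n.
Proof.
  induction n as [|n IH]; intros Hg.
  - rewrite sum_C_0. exact (Sigma_zero x y).
  - assert (Hg' : forall k, (1 <= k <= n)%nat -> S_space U (g k))
      by (intros; apply Hg; lia).
    assert (E : (fun t => sum_n_m (fun k => c k * g k t) 1 (S n))
      = (fun t => 1 * sum_n_m (fun k => c k * g k t) 1 n + c (S n) * g (S n) t)).
    { apply functional_extensionality; intros t. rewrite sum_C_S. Cring. }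
    rewrite E, sum_C_S, <- (IH Hg').
    rewrite (frac_sum_A3 _ _ ax _ _ x y 1 (c (S n))
      (subspace_sum _ n c g SU Hg') (Hg (S n) ltac:(lia))). Cring.
Qed.

(** (A1) split at 0 counts the term [Sigma g 1 1] on both sides. *)
Lemma Sigma_one_zero (g : C -> C) : S_space U g -> Sigma g 1 0 = 0.
Proof.
  intros Hg. generalize (frac_sum_A1 _ _ ax g 1 0 0 Hg).
  rewrite Cplus_0_l. generalize (frac_sum_A1 _ _ ax g 1 0 1 Hg).
  rewrite Cplus_0_l. intros E _.
  replace (Sigma g 1 0) with (Sigma g 1 0 + Sigma g 1 1 - Sigma g 1 1) by ring.
  rewrite E. ring.
Qed.

(** By (A2) the last term is the sum from [1 + h] to [x + h], which (A1) joins to the sum from 1 to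
    [h]. *)
Lemma Sigma_translate (g : C -> C) (x h : C) : S_space U g ->
  Sigma g 1 (x + h) = Sigma g 1 h + Sigma (shift h g) 1 x.
Proof.
  intros Hg.
  rewrite <- (frac_sum_A2 _ _ ax g 1 x h Hg), (Cplus_comm 1 h).
  symmetry. now apply (frac_sum_A1 _ _ ax).
Qed.

Lemma Sigma_difference (g : C -> C) (x : C) : S_space U g ->
  Sigma g 1 x - Sigma g 1 (x - 1) = g x.
Proof.
  intros Hg. replace x with (1 + (x - 1)) at 1 by ring.
  rewrite (Sigma_translate g 1 (x - 1) Hg).
  rewrite (frac_sum_A4 _ _ ax _ (S_space_shift U (x - 1) g Hg)).
  unfold shift. replace (1 + (x - 1)) with x by ring. ring.
Qed.

(* One step of the hypotheses (i), (ii), with [g], [g'] in place of two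
   consecutive derivatives of [f]. *)
Lemma Sigma_increment (g g' : C -> C) (n : nat) (u : C -> C)
    (v w : nat -> C -> C) :
  (forall x h, g (x + h) - g x
     = u h * g' x + sum_n_m (fun m => v m h * w m x) 1 n) ->
  S_space U g -> S_space U g' ->
  (forall m, (1 <= m <= n)%nat -> S_space U (w m)) ->
  forall x h, Sigma g 1 (x + h) = Sigma g 1 h + Sigma g 1 x
    + u h * Sigma g' 1 x + sum_n_m (fun m => v m h * Sigma (w m) 1 x) 1 n.
Proof.
  intros Hii Sg Sg' Sw x h.
  rewrite (Sigma_translate g x h Sg), <- (Sigma_sum n (fun m => v m h) w 1 x Sw).
  pose proof (subspace_sum _ n (fun m => v m h) w SU Sw) as Ss.
  pose proof (proj2 SU _ _ (u h) 1 Sg' Ss) as Sr. simpl in Sr.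
  (* The explicit factors 1 give the shape required by (A3), which is used twice. *)
  replace (shift h g) with
    (fun t => 1 * g t + 1 * (u h * g' t + 1 * sum_n_m (fun m => v m h * w m t) 1 n)).
  - rewrite (frac_sum_A3 _ _ ax _ _ 1 x 1 1 Sg Sr).
    rewrite (frac_sum_A3 _ _ ax _ _ 1 x (u h) 1 Sg' Ss). ring.
  - apply functional_extensionality; intros t. unfold shift.
    replace (g (t + h)) with (g t + (g (t + h) - g t)) by ring.
    rewrite Hii. Cring.
Qed.

(** In [Sigma_increment] with [h] fixed, only the coefficients depend on [h]; the spanning functions
    are 1 and the fractional sums of [g], [g'] and the [w m]. *)
Lemma Sigma_translates_span (g g' : C -> C) (n : nat) (u : C -> C)
    (v w : nat -> C -> C) :
  (forall x h, g (x + h) - g x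
     = u h * g' x + sum_n_m (fun m => v m h * w m x) 1 n) ->
  S_space U g -> S_space U g' ->
  (forall m, (1 <= m <= n)%nat -> S_space U (w m)) ->
  exists l, forall h, span l (shift h (fun x => Sigma g 1 x)).
Proof.
  intros Hii Sg Sg' Sw.
  exists ((fun _ => RtoC 1) :: (fun x => Sigma g 1 x) :: (fun x => Sigma g' 1 x)
    :: map (fun m x => Sigma (w m) 1 x) (rev (seq 1 n))).
  intros h. exists (Sigma g 1 h), (RtoC 1), (u h).
  eapply span_ext; [|apply (span_sum (fun m x => Sigma (w m) 1 x) (fun m => v m h))].
  intros z. unfold shift. simpl.
  rewrite (Sigma_increment g g' n u v w Hii Sg Sg' Sw). Cring.
Qed.

(** Since [Sigma g 1 0 = 0], the essence is the derivative of [Sigma g 1] at 0. *)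
Lemma essence_at_zero (g : C -> C) : S_space U g ->
  entire (fun x => Sigma g 1 x) ->
  filterlim (fun h => 1 / h * Sigma g 1 h) (locally' (RtoC 0))
    (locally (ess Sigma g)).
Proof.
  intros Sg Hg. destruct (Hg 0) as [l Hl].
  apply is_C_derive_quotient in Hl.
  assert (L : filterlim (fun h => 1 / h * Sigma g 1 h) (locally' (RtoC 0)) (locally l)).
  { eapply filterlim_C_ext; [|reflexivity|exact Hl].
    intros h Hh. simpl. rewrite Cplus_0_l, (Sigma_one_zero g Sg). Cfield. exact Hh. }
  unfold ess. now rewrite (is_C_lim_unique _ _ _ L).
Qed.

(** Divide [Sigma_increment] by [h] and let [h] tend to 0. The delicate term is the one with
    [u h / h], about which nothing is assumed directly. *)
Lemma Sigma_derive (g : C -> C) (n : nat) (u : C -> C) (v w : nat -> C -> C) :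
  (forall m, (1 <= m <= n)%nat ->
     filterlim (fun h => v m h / h) (locally' (RtoC 0)) (locally (RtoC 0))) ->
  (forall x h, g (x + h) - g x
     = u h * C_derive g x + sum_n_m (fun m => v m h * w m x) 1 n) ->
  entire g -> S_space U g -> S_space U (C_derive g) ->
  (forall m, (1 <= m <= n)%nat -> S_space U (w m)) ->
  forall x, C_derive (fun t => Sigma g 1 t) x = ess Sigma g + Sigma (C_derive g) 1 x.
Proof.
  intros Hv Hii Hg Sg Sg' Sw x.
  assert (HG := frac_sum_A5 _ _ ax g Sg Hg).
  assert (Hess := essence_at_zero g Sg HG).
  assert (Hu : filterlim (fun h => u h / h * Sigma (C_derive g) 1 x)
            (locally' (RtoC 0)) (locally (Sigma (C_derive g) 1 x))).
  { destruct (classic (forall t, C_derive g t = 0)) as [Z|NZ].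
    - apply functional_extensionality in Z. rewrite Z, Sigma_zero.
      eapply filterlim_C_ext; [|reflexivity|apply filterlim_const].
      intros h _. simpl. ring.
    - apply not_all_ex_not in NZ. destruct NZ as [t Ht].
      assert (Hq := is_C_derive_quotient _ _ _ (C_derive_spec g t (Hg t))).
      assert (Hs := filterlim_negligible_sum n v (fun m => w m t) Hv).
      eapply filterlim_C_ext;
        [| |exact (filterlim_C_scal _ (Sigma (C_derive g) 1 x / C_derive g t) _
               (filterlim_C_plus _ _ _ _ Hq (filterlim_C_scal _ (- (1)) _ Hs)))].
      + intros h Hh. simpl. rewrite Hii. Cfield. now split.
      + field. exact Ht. }
  assert (Hs := filterlim_negligible_sum n v (fun m => Sigma (w m) 1 x) Hv).
  assert (Hq := is_C_derive_quotient _ _ _ (C_derive_spec _ x (HG x))).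
  apply is_C_lim_unique in Hq. rewrite <- Hq.
  apply is_C_lim_unique.
  eapply filterlim_C_ext;
    [| |exact (filterlim_C_plus _ _ _ _ (filterlim_C_plus _ _ _ _ Hess Hu) Hs)].
  - intros h Hh. simpl.
    rewrite (Sigma_increment g (C_derive g) n u v w Hii Sg Sg' Sw).
    Cfield. exact Hh.
  - ring.
Qed.

End FractionalSum.

(** * Taylor coefficients of the fractional sum *)

(** Every derivative of [f] is the corresponding difference of derivatives of [F]. This is how
    holomorphy of all derivatives of [f] is obtained, from [F] the fractional sum and [c = 1]. *)
Lemma C_derive_n_difference (F f : C -> C) (c : C) :
  (forall k z, is_derive (C_derive_n F k) z (C_derive_n F (S k) z)) ->
  (forall x, f x = F x - F (x - c)) ->
  forall k, entire (C_derive_n f k).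
Proof.
  intros HF Hf.
  assert (HD : forall k z, is_derive
    (fun x => C_derive_n F k x - C_derive_n F k (x - c)) z
    (C_derive_n F (S k) z - C_derive_n F (S k) (z - c))).
  { intros k z. eapply is_C_derive_eq;
      [ | | exact (is_C_derive_plus _ _ _ _ _ (HF k z) (is_C_derive_scal _ (- (1)) _ _
              (is_C_derive_shift _ (- c) z _ (HF k (z + - c)))))].
    - intros t. unfold shift, Cminus. Cring.
    - unfold Cminus. Cring. }
  assert (E : forall k, C_derive_n f k
    = fun x => C_derive_n F k x - C_derive_n F k (x - c)).
  { induction k as [|k IH].
    - apply functional_extensionality. exact Hf.
    - change (C_derive_n f (S k)) with (C_derive (C_derive_n f k)). rewrite IH.
      apply functional_extensionality. intros z.
      apply is_C_derive_unique, HD. }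
  intros k z. rewrite E. eexists. apply HD.
Qed.

Theorem theorem4p3p3 :
  forall (f : C -> C) (n : nat)
    (u : nat -> C -> C) (v w : nat -> nat -> C -> C)
    (U : (C -> C) -> Prop) (Sigma : (C -> C) -> C -> C -> C),
  entire f ->
  (forall lambda m : nat, (1 <= m <= n)%nat ->
     filterlim (fun h => v m lambda h / h) (locally' (RtoC 0))
       (locally (RtoC 0))) ->
  (forall (lambda : nat) (x h : C),
     C_derive_n f lambda (x + h) - C_derive_n f lambda x
     = u lambda h * C_derive_n f (S lambda) x
       + sum_n_m (fun m => v m lambda h * w m lambda x) 1 n) ->
  summable_set U ->
  frac_sum_axioms U Sigma ->
  (forall lambda : nat, S_space U (C_derive_n f lambda)) ->
  (forall lambda m : nat, (1 <= m <= n)%nat -> S_space U (w m lambda)) ->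
  (forall k : nat, has_essence Sigma (C_derive_n f k)) /\
  (forall x y : C, exists s : C,
     is_series
       (fun j : nat =>
          (ess Sigma (C_derive_n f j) + Sigma (C_derive_n f (S j)) 1 y)
          * ((x - y) ^ S j / NtoC (fact (S j)))) s /\
     Sigma f 1 x = Sigma f 1 y + s) /\
  (forall x : C,
     is_series
       (fun j : nat =>
          ess Sigma (C_derive_n f j) * (x ^ S j / NtoC (fact (S j))))
       (Sigma f 1 x)).
Proof.
  intros f n u v w U Sigma Hf Hv Hii _ ax Sf Sw.
  set (F := fun x => Sigma f 1 x).
  destruct (Sigma_translates_span U Sigma ax f (C_derive f) n (u 0%nat)
    (fun m => v m 0%nat) (fun m => w m 0%nat) (Hii 0%nat) (Sf 0%nat) (Sf 1%nat)
    (Sw 0%nat)) as [l Hl].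
  destruct (finite_type_derive F l (frac_sum_A5 _ _ ax f (Sf 0%nat) Hf) Hl)
    as [HD HT].
  assert (Hfk : forall k, entire (C_derive_n f k)).
  { apply (C_derive_n_difference F f 1 HD).
    intros x. symmetry. exact (Sigma_difference U Sigma ax f x (Sf 0%nat)). }
  assert (HF : forall k, C_derive_n F (S k)
    = fun x => ess Sigma (C_derive_n f k) + Sigma (C_derive_n f (S k)) 1 x).
  { assert (HS : forall k x, C_derive (fun t => Sigma (C_derive_n f k) 1 t) x
      = ess Sigma (C_derive_n f k) + Sigma (C_derive_n f (S k)) 1 x).
    { intros k. exact (Sigma_derive U Sigma ax (C_derive_n f k) n (u k)
        (fun m => v m k) (fun m => w m k) (Hv k) (Hii k) (Hfk k) (Sf k)
        (Sf (S k)) (Sw k)). }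
    induction k as [|k IH]; apply functional_extensionality; intros x.
    - apply (HS 0%nat).
    (* By [HS] it remains to differentiate the formula [IH], in which the essence is a constant. *)
    - rewrite <- HS.
      change (C_derive_n F (S (S k))) with (C_derive (C_derive_n F (S k))).
      rewrite IH. apply is_C_derive_unique.
      assert (HG := frac_sum_A5 _ _ ax _ (Sf (S k)) (Hfk (S k))).
      eapply is_C_derive_eq;
        [ | | exact (is_C_derive_plus _ _ _ _ _
                (is_C_derive_const (ess Sigma (C_derive_n f k)) x)
                (C_derive_spec _ x (HG x)))]; [reflexivity|]. Cring. }
  assert (HE : forall x y, is_series
       (fun j : nat =>
          (ess Sigma (C_derive_n f j) + Sigma (C_derive_n f (S j)) 1 y)
          * ((x - y) ^ S j / NtoC (fact (S j)))) (F x - F y)).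
  { intros x y.
    assert (T := HT y (x - y)). replace (y + (x - y)) with x in T by ring.
    apply (is_series_ext (V := C_NormedModule) (fun j => C_derive_n F (S j) y
            * ((x - y) ^ S j / NtoC (fact (S j))))).
    { intros j. now rewrite HF. }
    (* Dropping the term [k = 0], which equals [F y], shifts the index: the term [j] here is the
       term of degree [j + 1]. *)
    refine (is_series_incr_1 (V := C_NormedModule) (fun k =>
      C_derive_n F k y * ((x - y) ^ k / NtoC (fact k))) (F x - F y) _).
    match goal with |- is_series _ ?s => replace s with (F x) end; [exact T|].
    change (F x = F x - F y + F y * (1 / NtoC 1)). unfold NtoC. simpl. field. }
  split; [|split].
  - intros k. exists (ess Sigma (C_derive_n f k)).
    apply (essence_at_zero U Sigma ax _ (Sf k)).
    exact (frac_sum_A5 _ _ ax _ (Sf k) (Hfk k)).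
  - intros x y. exists (F x - F y). split; [apply HE|]. unfold F. ring.
  - intros x.
    (* At [y = 0] all the fractional sums from 1 to [y] vanish, in the coefficients as well as in
       [F 0]. *)
    assert (T := HE x 0).
    replace (F x - F 0) with (Sigma f 1 x) in T
      by (unfold F; rewrite (Sigma_one_zero U Sigma ax f (Sf 0%nat)); ring).
    refine (is_series_ext (V := C_NormedModule) _ _ _ _ T).
    intros j. rewrite (Sigma_one_zero U Sigma ax _ (Sf (S j))).
    replace (x - 0) with x by ring. Cring.
Qed.
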